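(* Let $\mathcal Z$ be a convex set and let $f,r:\mathcal Z\to\mathbb{R}$ be convex and differentiable. If $f$ is $L$-relatively smooth with respect to $r$, i.e. $V^f_x(y)\le L\,V^r_x(y)$ for all $x,y\in\mathcal Z$, then the operator $g$ defined by $g(x)=\nabla f(x)$ for all $x$ is $L$-relatively Lipschitz with respect to $r$.
   Context: $\mathcal Z$ is a convex subset of a finite-dimensional real space. Bregman divergence: $V^r_x(y)=r(y)-r(x)-\langle\nabla r(x),y-x\rangle$. $g$ is $\lambda$-relatively Lipschitz with respect to $r$ if for every three $z,w,u\in\mathcal Z$, $\langle g(w)-g(z),w-u\rangle\le\lambda(V^r_z(w)+V^r_w(u))$. *)

(* Defs.v *)
From HB Require Import structures.
From mathcomp Require Import all_boot all_order all_algebra.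
From mathcomp Require Import all_classical all_reals all_analysis.

Set Implicit Arguments.
Unset Strict Implicit.
Unset Printing Implicit Defensive.

Import Order.TTheory GRing.Theory Num.Theory.
Import numFieldNormedType.Exports.

Local Open Scope classical_set_scope.
Local Open Scope ring_scope.

(* A function [Z -> R] is represented by a total function of which only the
   values on [Z] matter: convexity is required on [Z] only, and
   differentiability at a point [x] of [Z] is Fréchet differentiability along
   the trace on [Z] of the neighbourhoods of [x],
     f y = f x + 'd f (y - x) + o(y - x)    as y --> x with y in Z,
   so that [Z] need not be open.  When [x] is interior to [Z] this is ordinary
   differentiability at [x]. *)

Definition dotprod (R : realType) (n : nat) (u v : 'rV[R]_n) : R :=
  \sum_(i < n) u 0 i * v 0 i.

Definition differentiable_on (R : realType) (n : nat) (Z : set 'rV[R]_n)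
    (f : 'rV[R]_n -> R) : Prop :=
  forall x, Z x -> differentiable f (within Z (nbhs x)).

(* The differential relative to [Z] is unique if [Z] has nonempty interior.
   Otherwise [grad] is one of the possible gradients; for convex [Z], the
   products [dotprod (grad Z f x) (y - y')] with [x], [y], [y'] in [Z], the only
   ones used below, do not depend on which. *)
Definition grad (R : realType) (n : nat) (Z : set 'rV[R]_n)
    (f : 'rV[R]_n -> R) (x : 'rV[R]_n) : 'rV[R]_n :=
  \row_(i < n) 'd f (within Z (nbhs x)) (delta_mx 0 i).

Definition bregman (R : realType) (n : nat) (Z : set 'rV[R]_n)
    (r : 'rV[R]_n -> R) (x y : 'rV[R]_n) : R :=
  r y - r x - dotprod (grad Z r x) (y - x).

Definition rel_smooth (R : realType) (n : nat) (Z : set 'rV[R]_n) (L : R)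
    (f r : 'rV[R]_n -> R) : Prop :=
  forall x y, Z x -> Z y -> bregman Z f x y <= L * bregman Z r x y.

Definition rel_lipschitz (R : realType) (n : nat) (Z : set 'rV[R]_n) (lambda : R)
    (g : 'rV[R]_n -> 'rV[R]_n) (r : 'rV[R]_n -> R) : Prop :=
  forall z w u, Z z -> Z w -> Z u ->
    dotprod (g w - g z) (w - u) <=
      lambda * (bregman Z r z w + bregman Z r w u).

(* Main.v *)
(** Expanding the definitions gives the three-point identity
      <g w - g z, w - u> = V^f_z(w) + V^f_w(u) - V^f_z(u).
    The last divergence is nonnegative because a convex function lies above its
    tangents, and relative smoothness bounds the first two by L V^r. *)
Require Import Defs.
From HB Require Import structures.
From mathcomp Require Import all_boot all_order all_algebra.
From mathcomp Require Import all_classical all_reals all_analysis.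
From mathcomp Require Import ring lra.

Import Order.TTheory GRing.Theory Num.Theory.
Import numFieldNormedType.Exports.

Local Open Scope classical_set_scope.
Local Open Scope ring_scope.

(** Linearity of the differential, applied to the coordinate expansion of [v]; it lets the gradient
    be traded for ['d f]. *)
Lemma dotprod_grad (R : realType) (n : nat) (Z : set 'rV[R]_n)
    (f : 'rV[R]_n -> R) (x v : 'rV[R]_n) :
  dotprod (grad Z f x) v = 'd f (within Z (nbhs x)) v.
Proof.
rewrite [in RHS](row_sum_delta v) linear_sum; apply: eq_bigr => i _.
by rewrite linearZ mxE mulrC.
Qed.

Lemma dotprodBl (R : realType) (n : nat) (u v w : 'rV[R]_n) :
  dotprod (u - v) w = dotprod u w - dotprod v w.
Proof. by rewrite -sumrB; apply: eq_bigr => i _; rewrite !mxE mulrBl. Qed.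

Lemma dotprodBr (R : realType) (n : nat) (u v w : 'rV[R]_n) :
  dotprod w (u - v) = dotprod w u - dotprod w v.
Proof. by rewrite -sumrB; apply: eq_bigr => i _; rewrite !mxE mulrBr. Qed.

(** The little-o of the relative differential in epsilon form, with membership in [Z] turned from a
    filter into a premise. *)
Lemma differentiable_within_near (R : realType) (V : normedModType R)
    (Z : set V) (f : V -> R) (x : V) (e : R) :
  Z x -> differentiable f (within Z (nbhs x)) -> 0 < e ->
  \forall y \near x, Z y ->
    `|f y - f x - 'd f (within Z (nbhs x)) (y - x)| <= e * `|y - x|.
Proof.
move=> Zx [[_ /eqaddoP fE]] /fE.
have pF := within_nbhs_proper (subset_closure Zx).
(* A differential along a filter is centred at the limit of the filter. Here [Z x] makes the filter
   proper, so in a Hausdorff space this limit is [x]. *)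
have -> : lim (within Z (nbhs x)) = x.
  by apply: (@cvg_lim _ (@norm_hausdorff _ V) _ _ pF id); exact: cvg_within.
by rewrite near_withinE; apply: filterS => y fy /fy /=; rewrite opprD addrA.
Qed.

(** On the segment from [x] to [y], which stays in [Z], the chord bounds [f] from above and the
    expansion at [x] bounds it from below, up to a small error. Dividing by [t] compares the two
    slopes. *)
Lemma bregman_ge0 (R : realType) (n : nat) (Z : set 'rV[R]_n)
    (f : 'rV[R]_n -> R) (x y : 'rV[R]_n) :
  convex_set Z -> convex_function Z f -> differentiable_on Z f ->
  Z x -> Z y -> 0 <= bregman Z f x y.
Proof.
move=> Zconvex fconvex fdiff Zx Zy.
rewrite /bregman dotprod_grad; set d := 'd f (within Z (nbhs x)).
apply/ler_addgt0Pl => e e0.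
(* With this slope [k] the error at parameter [t] is at most [t * e]; the [+ 1] covers [y = x]. *)
have k0 : 0 < e / (`|y - x| + 1) by rewrite divr_gt0 // ltr_wpDl.
set k := e / _ in k0.
have ke : k * `|y - x| <= e.
  by rewrite /k mulrAC ler_pdivrMr ?ltr_wpDl // ler_pM2l // lerDl.
have path_cvg : (x + t *: (y - x)) @[t --> (0 : R)^'+] --> x.
  rewrite -[X in _ --> X]addr0 -(scale0r (y - x)).
  apply: cvgD; first exact: cvg_cst.
  by apply: cvgZr_tmp; apply: cvg_at_right_filter; exact: cvg_id.
(* Membership in [Z] stays a premise until a [t] between 0 and 1 is fixed. *)
have ft_near : \forall t \near (0 : R)^'+, Z (x + t *: (y - x)) ->
    `|f (x + t *: (y - x)) - f x - d (t *: (y - x))| <= k * `|t *: (y - x)|.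
  have := path_cvg _
    (differentiable_within_near _ _ _ _ _ _ Zx (fdiff x Zx) k0).
  by rewrite nbhs_simpl /=; apply: filterS => t /=; rewrite [x + _]addrC addrK.
near (0 : R)^'+ => t.
have t0 : 0 < t by near: t; exact: nbhs_right_gt.
have t1 : t < 1 by near: t; exact: nbhs_right_lt.
have convE : conv (Itv01 (ltW t0) (ltW t1)) (y : convex_lmodType 'rV[R]_n) x =
    x + t *: (y - x).
  by rewrite /conv /= scalerBl scale1r scalerBr addrCA.
have xtZ : Z (x + t *: (y - x)).
  by apply/set_mem; rewrite -convE; apply: Zconvex; exact/mem_set.
have secant : f (x + t *: (y - x)) <= t * f y + (1 - t) * f x.
  have := fconvex (Itv01 (ltW t0) (ltW t1)) y x (mem_set Zy) (mem_set Zx).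
  by rewrite convE.
have tangent : t * d (y - x) - k * (t * `|y - x|) <= f (x + t *: (y - x)) - f x.
  have : `|f (x + t *: (y - x)) - f x - d (t *: (y - x))| <= k * `|t *: (y - x)|.
    by move: xtZ; near: t; exact: ft_near.
  rewrite linearZ normrZ (gtr0_norm t0) ler_norml => /andP[+ _].
  by rewrite lerBrDl.
(* Chaining [tangent] with [secant] gives this inequality; cancelling [t > 0] and using [ke] yields
   the goal. *)
suff : 0 <= t * (f y - f x - d (y - x) + k * `|y - x|).
  by rewrite pmulr_rge0 //; lra.
by lra.
Unshelve. all: by end_near. Qed.

Theorem lemma2 (R : realType) (n : nat) (Z : set 'rV[R]_n)
    (f r : 'rV[R]_n -> R) (g : 'rV[R]_n -> 'rV[R]_n) (L : R)
    (Zconvex : convex_set Z)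
    (fconvex : convex_function Z f) (fdiff : differentiable_on Z f)
    (rconvex : convex_function Z r) (rdiff : differentiable_on Z r)
    (fsmooth : rel_smooth Z L f r)
    (gE : forall x, Z x -> g x = grad Z f x) :
  rel_lipschitz Z L g r.
Proof.
move=> z w u Zz Zw Zu; rewrite !gE // mulrDr.
apply: le_trans (lerD (fsmooth _ _ Zz Zw) (fsmooth _ _ Zw Zu)).
have -> : dotprod (grad Z f w - grad Z f z) (w - u) =
    bregman Z f z w + bregman Z f w u - bregman Z f z u.
  rewrite /bregman; move: (grad Z f w) (grad Z f z) => gw gz.
  by rewrite dotprodBl !dotprodBr; ring.
by rewrite gerBl; exact: bregman_ge0.
Qed.
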